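(* Let $c,d\in\mathbb{Z}$. For any prime $p>3$, we have $$\det[(i^2+cij+dj^2)^{p-2}]_{0\le i,j\le p-1}\equiv 0\pmod p.$$
   Context: $[a_{ij}]_{0\le i,j\le p-1}$ denotes the $p\times p$ integer matrix with rows and columns indexed by $0,1,\ldots,p-1$ whose $(i,j)$ entry is $a_{ij}$. *)

(* Defs.v *)
From mathcomp Require Export all_boot all_order all_algebra.
Set Implicit Arguments.
Unset Strict Implicit.
Unset Printing Implicit Defensive.

(* Main.v *)
Require Import Defs.
From mathcomp Require Import all_boot all_order all_algebra.
From mathcomp Require Import finfield ring.
Import Order.TTheory GRing.Theory Num.Theory.
Local Open Scope ring_scope.

(** Over a finite field of p elements, the matrix has linearly dependent rows.
    Put [n = p - 2]. The row of index 0 is [d^n y^(2n)].  For [y <> 0] the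
    substitution [x = t y] shows that the sum of the rows of index [x <> 0] is
    [l y^(2n)], with [l] independent of [y]; at [y = 0] that sum is
    [sum_x x^(2n) = sum_(x <> 0) x^(-2)], which vanishes as soon as some unit
    has a square different from 1, so for [p > 3].  Both rows are thus
    multiples of [y^(2n)]. *)

(** Multiplication by [a] permutes [F], so the sum equals [a ^+ m] times itself. *)
Lemma sum_expr_eq0 (F : finFieldType) (a : F) (m : nat) :
  a != 0 -> a ^+ m != 1 -> \sum_(x : F) x ^+ m = 0.
Proof.
move=> a0 am1; set S := \sum_x _.
have aS : S = a ^+ m * S.
  rewrite {1}/S (reindex_inj (mulfI a0)) mulr_sumr /=.
  by apply: eq_bigr => x _; rewrite exprMn.
apply/eqP; rewrite -[_ == 0]/(false || _) -(negbTE am1) -subr_eq0 -mulf_eq0.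
by rewrite mulrBl mul1r -aS subrr.
Qed.

Lemma quadratic_form_rows_dependent (F : finFieldType) (c d : F) (n : nat) :
    (0 < n)%N -> \sum_(x : F) x ^+ (2 * n) = 0 ->
  exists2 u : F -> F, exists x, u x != 0 &
    forall y, \sum_x u x * (x ^+ 2 + c * x * y + d * y ^+ 2) ^+ n = 0.
Proof.
move=> n_gt0 S0.
have row0 y : (0 ^+ 2 + c * 0 * y + d * y ^+ 2) ^+ n = d ^+ n * y ^+ (2 * n).
  by rewrite expr0n mulr0 mul0r !add0r exprMn exprM.
have zero_pow : 0 ^+ (2 * n) = 0 :> F by rewrite expr0n muln_eq0 /= gtn_eqF.
pose l := \sum_(t : F | t != 0) (t ^+ 2 + c * t + d) ^+ n.
have rows y : \sum_(x | x != 0) (x ^+ 2 + c * x * y + d * y ^+ 2) ^+ n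
              = l * y ^+ (2 * n).
  have [->|y0] := eqVneq y 0.
    rewrite zero_pow mulr0 -[RHS]S0 [RHS](bigD1 0) //= zero_pow add0r.
    by apply: eq_bigr => x _; rewrite mulr0 expr0n mulr0 !addr0 exprM.
  rewrite (reindex_inj (mulIf y0)) mulr_suml /=; apply: eq_big => t.
    by rewrite mulf_eq0 (negbTE y0) orbF.
  by move=> _; rewrite exprM -exprMn; congr (_ ^+ n); ring.
(* If [d ^+ n] is 0, row 0 vanishes and is a dependency by itself. Otherwise [d ^+ n] times the sum
   of the other rows cancels [l] times row 0, and the coefficient at 1 is nonzero. *)
have [dn0|dn0] := eqVneq (d ^+ n) 0.
  exists (fun x => (x == 0)%:R); first by exists 0; rewrite eqxx oner_neq0.
  move=> y; rewrite (bigD1 0) //= row0 dn0 mul0r mulr0 add0r big1 // => x x0.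
  by rewrite (negbTE x0) mul0r.
exists (fun x => if x == 0 then - l else d ^+ n).
  by exists 1; rewrite oner_eq0.
move=> y; rewrite (bigD1 0) //= eqxx row0.
under eq_bigr => x /negbTE x0 do rewrite x0.
by rewrite -mulr_sumr rows; ring.
Qed.

Lemma natr_Fp_bij (p : nat) : prime p ->
  bijective (fun i : 'I_p => (i : nat)%:R : 'F_p).
Proof.
move=> p_prime; apply: inj_card_bij; last by rewrite card_Fp // card_ord.
move=> i j /(congr1 val); rewrite /= !val_Fp_nat // !modn_small //.
exact: val_inj.
Qed.

Theorem theorem1p6 (c d : int) (p : nat) (p_prime : prime p) (p_gt3 : (3 < p)%N) :
  (\det (\matrix_(i < p, j < p)
           ((i%:Z ^+ 2 + c * i%:Z * j%:Z + d * j%:Z ^+ 2) ^+ (p - 2)%N) : 'M[int]_p)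
     = 0 %[mod p%:Z])%Z.
Proof.
apply/eqP; rewrite eqz_mod_dvd subr0.
have pcharFp := pchar_Fp p_prime.
rewrite (dvdz_pcharf pcharFp) -det_map_mx; apply/det0P.
have nat_neq0 k : (0 < k < p)%N -> k%:R != 0 :> 'F_p.
  by case/andP=> k0 kp; rewrite -(dvdn_pcharf pcharFp) gtnNdvd.
have two_neq0 : 2%:R != 0 :> 'F_p by apply: nat_neq0; rewrite (ltn_trans _ p_gt3).
have S0 : \sum_(x : 'F_p) x ^+ (2 * (p - 2)) = 0.
  (* The unit 2 works because [2 ^ 2 - 1 = 3] is nonzero for [p > 3]. *)
  apply: (sum_expr_eq0 _ 2%:R) => //; apply/eqP => pow1.
  have /eqP[] := nat_neq0 3 p_gt3.
  have fermat : 2%:R ^+ (p - 1) = 1 :> 'F_p.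
    apply: (mulIf two_neq0); rewrite /= -exprSr subn1 prednK ?prime_gt0 // mul1r.
    by have := expf_card (2%:R : 'F_p); rewrite card_Fp.
  have four : 2%:R ^+ 2 = 1 :> 'F_p.
    (* Since [2 * (p - 2) + 2 = 2 * (p - 1)], [pow1] and Fermat force [2 ^ 2 = 1]. *)
    rewrite -[LHS]mul1r -{1}pow1 -exprD -mulnSr -subSn ?prime_gt1 //.
    by rewrite subSS mulnC exprM fermat expr1n.
  have -> : 3%:R = 2%:R ^+ 2 - 1 :> 'F_p by ring.
  by rewrite four subrr.
have [|u [x ux] uM] := quadratic_form_rows_dependent _ c%:~R d%:~R (p - 2) _ S0.
  by rewrite subn_gt0 (ltn_trans _ p_gt3).
have bij := natr_Fp_bij _ p_prime; have [g _ gK] := bij.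
(* Reading [u] along the bijection from indices to residues gives a left kernel vector of the matrix
   mod [p]; its entry at [g x] is [u x], hence nonzero. *)
exists (\row_i u (i : nat)%:R).
  by apply: contraNneq ux => /rowP/(_ (g x)); rewrite !mxE gK => ->.
apply/rowP => j; rewrite !mxE -[RHS](uM (j : nat)%:R).
rewrite [RHS](reindex _ (onW_bij _ bij)) /=.
apply: eq_bigr => i _; rewrite !mxE.
by rewrite !(rmorphXn, rmorphD, rmorphM) /= !pmulrn.
Qed.
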